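(* Let $D \ge 1$, let $E_1, E_2 \ge 0$ be real numbers, and let $$A = \begin{bmatrix} -\mathrm{I} \\ \mathbf{1}^T \\ -\mathbf{1}^T \end{bmatrix} \in \mathbb{R}^{(D+2) \times D}, \qquad b_k = \begin{bmatrix} 0 \\ E_k \\ -E_k \end{bmatrix} \in \mathbb{R}^{D+2} \quad (k = 1, 2),$$ where $\mathrm{I}$ is the $D \times D$ identity matrix, $\mathbf{1}^T = (1, \dots, 1)$ is the all-ones row vector of length $D$, and the first block of $b_k$ is the zero vector of $\mathbb{R}^D$. Consider the two deferrable loads with energy requirements $E_1$ and $E_2$, present over the same $D$ time periods, i.e. the polytopes $\mathbf{P}_k = \{x \in \mathbb{R}^D \mid A x \le b_k\}$, $k = 1, 2$. Then their outer Minkowski approximation is exact and is given by $\mathbf{P} = \{x \in \mathbb{R}^D \mid A x \le b'\}$, where $$b' = \begin{bmatrix} 0 \\ E_1 + E_2 \\ -(E_1 + E_2) \end{bmatrix}.$$ That is, $\{x + y \mid x \in \mathbf{P}_1,\ y \in \mathbf{P}_2\} = \mathbf{P}$.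
   Context: Vector inequalities are componentwise. A deferrable load with energy requirement $E$ over $D$ time periods is a load whose power use $x \in \mathbb{R}^D$ is nonnegative in every period and whose total energy consumption $\sum_{i=1}^D x(i)$ equals $E$. For two polytopes $\{x \mid A x \le b_1\}$ and $\{x \mid A x \le b_2\}$ in $\mathbb{R}^D$ described with the same matrix $A$, their outer Minkowski approximation is the polytope $\{z \mid A z \le b_1 + b_2\}$. It is called exact if it equals the Minkowski sum of the two polytopes. *)

(* Defs.v *)
(* A realType is, up to isomorphism, the field of real numbers. *)
From HB Require Import structures.
From mathcomp Require Import all_boot all_order all_algebra.
From mathcomp Require Import boolp classical_sets reals.

Set Implicit Arguments.
Unset Strict Implicit.
Unset Printing Implicit Defensive.

Import Order.TTheory GRing.Theory Num.Theory.
Local Open Scope ring_scope.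
Local Open Scope classical_set_scope.

Definition cvle (R : realType) (m : nat) (u v : 'cV[R]_m) : Prop :=
  forall i : 'I_m, u i 0 <= v i 0.

(* Boundedness is not part of this definition; the notions below depend only
   on the description (A, b). *)
Definition polyhedron (R : realType) (m n : nat) (A : 'M[R]_(m, n))
    (b : 'cV[R]_m) : set 'cV[R]_n :=
  [set x | cvle (A *m x) b].

Definition minkowski_sum (R : realType) (n : nat) (P Q : set 'cV[R]_n) :
    set 'cV[R]_n :=
  [set x + y | x in P & y in Q].

(* This depends on the chosen description (A, b1, b2), not only on the two
   sets being described. *)
Definition outer_minkowski (R : realType) (m n : nat) (A : 'M[R]_(m, n))
    (b1 b2 : 'cV[R]_m) : set 'cV[R]_n :=
  polyhedron A (b1 + b2).

Definition outer_minkowski_exact (R : realType) (m n : nat)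
    (A : 'M[R]_(m, n)) (b1 b2 : 'cV[R]_m) : Prop :=
  outer_minkowski A b1 b2 =
  minkowski_sum (polyhedron A b1) (polyhedron A b2).

(* The row count is D + (1 + 1), which is convertible to D + 2, so that the
   blocks of heights D, 1 and 1 can be stacked without casts. *)
Definition load_mx (R : realType) (D : nat) : 'M[R]_(D + (1 + 1), D) :=
  col_mx (- 1%:M) (col_mx (const_mx 1) (- const_mx 1)).

Definition load_rhs (R : realType) (D : nat) (E : R) : 'cV[R]_(D + (1 + 1)) :=
  col_mx 0 (col_mx (const_mx E) (const_mx (- E))).

Definition deferrable_load (R : realType) (D : nat) (E : R) : set 'cV[R]_D :=
  [set x | (forall i, 0 <= x i 0) /\ \sum_i x i 0 = E].

Lemma polyhedron_load (R : realType) (D : nat) (E : R) :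
  polyhedron (load_mx R D) (load_rhs D E) = deferrable_load E.
Proof.
have sumE (x : 'cV[R]_D) k :
    ((const_mx 1 : 'rV[R]_D) *m x) k 0 = \sum_i x i 0.
  by rewrite mxE; apply: eq_bigr => i _; rewrite mxE mul1r.
rewrite /polyhedron /deferrable_load; apply/seteqP; split=> x /=.
  rewrite /cvle /load_mx /load_rhs !mul_col_mx !mulNmx mul1mx => xE; split.
    by move=> i; have := xE (lshift _ i); rewrite !col_mxEu !mxE oppr_le0.
  apply/eqP; rewrite eq_le; apply/andP; split.
    by have := xE (rshift D (lshift 1 0)); rewrite !col_mxEd !col_mxEu sumE mxE.
  have := xE (rshift D (rshift 1 0)).
  by rewrite !col_mxEd mxE sumE [leRHS]mxE lerN2.
rewrite /cvle /load_mx /load_rhs !mul_col_mx !mulNmx mul1mx => -[x0 xE] i.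
case: (split_ordP i) => [j ->|j ->].
  by rewrite !col_mxEu !mxE oppr_le0.
rewrite !col_mxEd; case: (split_ordP j) => [k ->|k ->].
  by rewrite !col_mxEu sumE mxE xE.
by rewrite !col_mxEd mxE sumE [leRHS]mxE xE.
Qed.

(* Main.v *)
Require Import Defs.
From HB Require Import structures.
From mathcomp Require Import all_boot all_order all_algebra.
From mathcomp Require Import boolp classical_sets reals.
Import Order.TTheory GRing.Theory Num.Theory.
Local Open Scope ring_scope.
Local Open Scope classical_set_scope.

(** The polyhedra in play are the simplices of nonnegative vectors with a
    prescribed coordinate sum ([polyhedron_load]), and dilates of one convex set
    add up: a profile [z] of total energy [E1 + E2] is shared between the two
    loads in the constant proportion [t = E1 / (E1 + E2)], as
    [z = t *: z + (1 - t) *: z]. Both parts are nonnegative because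
    [0 <= t <= 1], and their sums are [E1] and [E2]
    ([minkowski_sum_deferrable_load]). Since the right-hand sides of the
    descriptions are additive in the energy ([load_rhsD]), the outer
    approximation is the same simplex as the Minkowski sum. *)

Lemma load_rhsD (R : realType) (D : nat) (E1 E2 : R) :
  load_rhs D (E1 + E2) = load_rhs D E1 + load_rhs D E2.
Proof.
by rewrite /load_rhs !add_col_mx addr0 opprD !raddfD.
Qed.

(** Adding profiles adds their energies, which gives one inclusion; for the
    other one, a profile is split proportionally to the two energies. *)
Lemma minkowski_sum_deferrable_load (R : realType) (D : nat) (E1 E2 : R) :
  0 <= E1 -> 0 <= E2 ->
  minkowski_sum (deferrable_load (D := D) E1) (deferrable_load E2) =
  deferrable_load (E1 + E2).
Proof.
move=> E1_ge0 E2_ge0; apply/seteqP; split=> z /=.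
  move=> [x [x_ge0 <-] [y [y_ge0 <-] <-]]; split.
    by move=> i; rewrite mxE addr_ge0.
  by rewrite -big_split; apply: eq_bigr => i _; rewrite mxE.
move=> [z_ge0 sum_z].
have E_ge0 : 0 <= E1 + E2 by rewrite addr_ge0.
pose t := E1 / (E1 + E2).
(* When E1 + E2 = 0, both energies vanish and the convention 0^-1 = 0 gives
   t = 0, so that the same splitting still works. *)
have tE : t * (E1 + E2) = E1.
  have [E0|E_neq0] := eqVneq (E1 + E2) 0; last by rewrite /t divfK.
  move/eqP: (E0); rewrite paddr_eq0 // => /andP[/eqP E1_0 _].
  by rewrite E0 mulr0 E1_0.
have t_ge0 : 0 <= t by rewrite divr_ge0.
have t_le1 : t <= 1.
  have [E0|E_neq0] := eqVneq (E1 + E2) 0.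
    by rewrite /t E0 invr0 mulr0 ler01.
  by rewrite ler_pdivrMr ?mul1r ?lerDl // lt0r E_neq0.
have sumZ (c : R) : \sum_i (c *: z) i 0 = c * (E1 + E2).
  by rewrite -sum_z mulr_sumr; apply: eq_bigr => i _; rewrite mxE.
exists (t *: z).
  by split=> [i|]; rewrite ?sumZ ?tE // mxE mulr_ge0.
exists ((1 - t) *: z); last by rewrite -scalerDl addrC subrK scale1r.
split=> [i|]; first by rewrite mxE mulr_ge0 // subr_ge0.
by rewrite sumZ mulrBl mul1r tE addrC addKr.
Qed.

Theorem proposition3 (R : realType) (D : nat) (E1 E2 : R)
    (D_ge1 : (1 <= D)%N) (E1_ge0 : 0 <= E1) (E2_ge0 : 0 <= E2) :
  let A := load_mx R D in
  let b1 := load_rhs D E1 in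
  let b2 := load_rhs D E2 in
  let b' := load_rhs D (E1 + E2) in
  [/\ outer_minkowski_exact A b1 b2,
      outer_minkowski A b1 b2 = polyhedron A b' &
      minkowski_sum (polyhedron A b1) (polyhedron A b2) = polyhedron A b'].
Proof.
move=> A b1 b2 b'.
have outerE : outer_minkowski A b1 b2 = polyhedron A b'.
  by rewrite /outer_minkowski /b' load_rhsD.
have sumE : minkowski_sum (polyhedron A b1) (polyhedron A b2) = polyhedron A b'.
  by rewrite !polyhedron_load minkowski_sum_deferrable_load.
by split=> //; rewrite /outer_minkowski_exact outerE sumE.
Qed.
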